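(* Let $i_1,\dots,i_n$ be a good enumeration of $I$. Then the reduced word of $w_0$ corresponding to the convex order $\prec$ on $\Phi^+$ attached to this enumeration is simply braided, i.e. it is simply braided for every $i\in I$.
   Context: Setting. $\mathfrak{g}$ is a simple finite-dimensional Lie algebra over $\mathbf{C}$ with index set $I$, $|I|=n$, simple roots $\alpha_i$, positive roots $\Phi^+$, $N=|\Phi^+|$, Weyl group $W$ with simple reflections $s_i$ and longest element $w_0$. A total order $\prec$ on $\Phi^+$ is convex if whenever $\beta'=\beta+\beta''$ with all three in $\Phi^+$, either $\beta\prec\beta'\prec\beta''$ or $\beta''\prec\beta'\prec\beta$. Reduced words $\mathbf{i}=(i_1,\dots,i_N)$ of $w_0$ are in bijection with convex orders on $\Phi^+$ (Papi) via $\beta_1\prec\cdots\prec\beta_N$, $\beta_k=s_{i_1}\cdots s_{i_{k-1}}\alpha_{i_k}$. Order attached to an enumeration $i_1,\dots,i_n$ of $I$. For $\beta=\sum p_i\alpha_i$, $\beta'=\sum p'_i\alpha_i$ in $\Phi^+$, set $\beta\prec\beta'$ if either (1) $\min\{k:p_{i_k}\ne0\}<\min\{k:p'_{i_k}\neq0\}$, or (2) these minima are equal to a common value $k$ and $\left(\frac{p_{i_{k+1}}}{p_{i_k}},\dots,\frac{p_{i_n}}{p_{i_k}}\right)<\left(\frac{p'_{i_{k+1}}}{p'_{i_k}},\dots,\frac{p'_{i_n}}{p'_{i_k}}\right)$ lexicographically. This is a convex order. Braidless nodes. For a (possibly reducible) finite root system with Weyl group $W'$, simple roots indexed by $I'$,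 and fundamental weights $\omega_j$, a node $i\in I'$ is braidless if for every $\tau\in W'$: whenever $\alpha\ne\gamma$ are simple roots with $\langle\alpha^\vee,\tau\omega_i\rangle>0$ and $\langle\gamma^\vee,\tau\omega_i\rangle>0$, then $\langle\alpha^\vee,\gamma\rangle=0$. Good enumeration. An enumeration $i_1,\dots,i_n$ of $I$ is good if each $i_k$ is braidless for the root system generated by $\{\alpha_{i_k},\dots,\alpha_{i_n}\}$. Simply braided. A reduced word $\mathbf{i}$ of $w_0$ is simply braided for $i\in I$ if one can perform a sequence of braid moves to $\mathbf{i}$ to get to a word $\mathbf{i}'$ with $i'_1=i$, where each move is either a $2$-term braid move (interchanging adjacent commuting letters) or a braid move such that $\alpha_i$ is the rightmost (in the convex order of the current word) of the roots affected. A braid move at positions $k,\dots,k+m-1$ affects the roots $\beta_k,\dots,\beta_{k+m-1}$ of the current word. *)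

(* Defs.v *)
From mathcomp Require Import all_boot all_order all_fingroup all_algebra.
From mathcomp Require Import reals.
From Stdlib Require Import Relation_Operators.

Set Implicit Arguments.
Unset Strict Implicit.
Unset Printing Implicit Defensive.

Import Order.TTheory GRing.Theory Num.Theory.
Local Open Scope ring_scope.

(* A simple complex Lie algebra enters only through its root system.  Roots
   live in the real span of the simple roots, an n-dimensional Euclidean space,
   which is taken to be R^n with the standard scalar product; the index set I
   is 'I_n. *)

Section RootSystems.
Variables (R : realType) (n : nat).
Local Notation V := 'rV[R]_n.

Definition dot (u v : V) : R := (u *m v^T) 0 0.

(* <a^vee, v>, with a^vee = 2 a / (a, a). *)
Definition copair (a v : V) : R := 2 * dot a v / dot a a.

Definition refl (a v : V) : V := v - copair a v *: a.

(* refls [:: a_1; ...; a_k] = s_{a_1} o ... o s_{a_k}. *)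
Definition refls (s : seq V) (v : V) : V := foldr refl v s.

Definition root_system (Phi : seq V) : Prop :=
  [/\ <<Phi>>%VS = fullv,
      0 \notin Phi,
      forall (a : V) (c : R), a \in Phi -> c *: a \in Phi -> c = 1 \/ c = -1,
      forall a b : V, a \in Phi -> b \in Phi -> refl a b \in Phi
    & forall a b : V, a \in Phi -> b \in Phi -> copair a b \is a Num.int].

Definition irreducible (Phi : seq V) : Prop :=
  Phi <> [::] /\
  forall P : pred V,
    (forall a b : V, a \in Phi -> b \in Phi -> P a -> ~~ P b -> dot a b = 0) ->
    {in Phi, forall a, P a} \/ {in Phi, forall a, ~~ P a}.

Variable Delta : n.-tuple V.
Local Notation alpha i := (tnth Delta i).

Definition is_base (Phi : seq V) : Prop :=
  [/\ basis_of fullv Delta,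
      {subset Delta <= Phi}
    & forall b : V, b \in Phi -> exists p : 'I_n -> nat,
        b = \sum_i (p i)%:R *: alpha i \/ b = - \sum_i (p i)%:R *: alpha i].

Definition pos_roots (Phi : seq V) : seq V :=
  [seq b <- Phi | [forall i, 0 <= coord Delta i b]].

Definition weyl (w : seq 'I_n) : V -> V := refls [seq alpha i | i <- w].

Definition reduced (w : seq 'I_n) : Prop :=
  forall w', weyl w' =1 weyl w -> (size w <= size w')%N.

(* w represents the element of maximal length. *)
Definition reduced_w0 (w : seq 'I_n) : Prop :=
  reduced w /\ forall w', reduced w' -> (size w' <= size w)%N.

(* The list of the beta_k = s_{i_1} ... s_{i_{k-1}} alpha_{i_k}. *)
Fixpoint betas (w : seq 'I_n) : seq V :=
  if w is i :: w' then alpha i :: [seq refl (alpha i) b | b <- betas w']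
  else [::].

Definition corresponds (Phi : seq V) (prec : rel V) (w : seq 'I_n) : Prop :=
  [/\ reduced_w0 w, betas w =i pos_roots Phi & pairwise prec (betas w)].

(* An enumeration i_1, ..., i_n of I is a permutation e of 'I_n, with
   i_{k+1} = e k since ordinals start at 0. *)

Section Enumeration.
Variable e : 'S_n.

(* The list p_{i_1}, ..., p_{i_n}. *)
Definition coefs (b : V) : seq R := [seq coord Delta (e k) b | k : 'I_n <- enum 'I_n].

Definition lead (b : V) : nat := find (fun x => x != 0) (coefs b).

Definition ratios (b : V) : seq R :=
  [seq x / (coefs b)`_(lead b) | x <- drop (lead b).+1 (coefs b)].

Definition prec (b b' : V) : bool :=
  (lead b < lead b')%N
  || (lead b == lead b') && (ratios b < ratios b' :> seqlexi R)%O.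

End Enumeration.

(* The notions for the root system with base S inside V: its Weyl group is
   the set of refls t with t a sequence in S, and its fundamental weights lie
   in the span of S. *)

Definition is_fund_weight (S : seq V) (a omega : V) : Prop :=
  omega \in <<S>>%VS /\ {in S, forall c, copair c omega = (c == a)%:R}.

Definition braidless (S : seq V) (a : V) : Prop :=
  forall omega : V, is_fund_weight S a omega ->
  forall t : seq V, {subset t <= S} ->
  forall c d : V, c \in S -> d \in S -> c != d ->
    0 < copair c (refls t omega) -> 0 < copair d (refls t omega) -> copair c d = 0.

Definition good_enumeration (e : 'S_n) : Prop :=
  forall k : 'I_n,
    braidless [seq alpha (e j) | j : 'I_n <- enum 'I_n & (k <= j)%N]
      (alpha (e k)).

(* alt i j m = [:: i; j; i; ...] with m letters. *)
Fixpoint alt (i j : 'I_n) (m : nat) : seq 'I_n :=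
  if m is m'.+1 then i :: alt j i m' else [::].

(* m is the order of s_i s_j. *)
Definition cox_order (i j : 'I_n) (m : nat) : Prop :=
  [/\ (0 < m)%N, weyl (alt i j m.*2) =1 id
    & forall m', (0 < m')%N -> weyl (alt i j m'.*2) =1 id -> (m <= m')%N].

(* The word w becomes w' by an m-term braid move at positions k+1, ..., k+m. *)
Definition braid_move (k m : nat) (w w' : seq 'I_n) : Prop :=
  exists (u v : seq 'I_n) (i j : 'I_n),
    [/\ i != j, cox_order i j m, size u = k,
        w = u ++ alt i j m ++ v & w' = u ++ alt j i m ++ v].

Definition affected (k m : nat) (w : seq 'I_n) : seq V :=
  take m (drop k (betas w)).

Definition allowed_move (i : 'I_n) (w w' : seq 'I_n) : Prop :=
  exists k m : nat,
    braid_move k m w w' /\ (m = 2 \/ last 0 (affected k m w) = alpha i).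

Definition simply_braided_for (i : 'I_n) (w : seq 'I_n) : Prop :=
  exists w' : seq 'I_n, clos_refl_trans _ (allowed_move i) w (i :: w').

Definition simply_braided (w : seq 'I_n) : Prop :=
  forall i, simply_braided_for i w.

End RootSystems.

(* Main.v *)
Require Import Defs.
From HB Require Import structures.
From mathcomp Require Import all_boot all_order all_fingroup all_algebra.
From mathcomp Require Import reals.
From mathcomp Require Import zify ring.
From Stdlib Require Import Relation_Operators Operators_Properties.

Set Implicit Arguments.
Unset Strict Implicit.
Unset Printing Implicit Defensive.

Import Order.TTheory GRing.Theory Num.Theory.
Local Open Scope ring_scope.

(** Write [al i] for the simple roots and [lead b] for the first index [k] such
    that the coefficient of [al (e k)] in [b] is nonzero.  The order puts all
    roots of lead 0 first, then those of lead 1, and so on, and [al (e k)] is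
    the first root of lead [k] (prec_simple).  So the word is a concatenation of blocks, and for
    [al i0] to come first it has to cross, from right to left, every block of
    lead smaller than its own (cross_blocks).

    Crossing the block of lead [k] (block_pass).  Let [v] be the product of the
    previous blocks; its inversions are exactly the positive roots of lead less
    than [k].  Let [x] be the part of the block that precedes the letter [i],
    where [v x (al i) = al i0].  If [j] is the last letter of [x], factor
    [x = y z], where [z] is alternating in [i] and [j] and [y] sends [al i] and
    [al j] to positive roots.  As [al i0] is indecomposable in the positive
    cone, [z (al i)] is [al i] or [al j], and this forces [z i] to be the
    longest element of the dihedral group of [i] and [j].  Provided [x] can be
    rewritten as [y z] by commutations, one braid move on [z i], whose rightmost
    affected root is [al i0], brings [al i0] in front of [z].  Induction on the
    length of [x] finishes the crossing.

    It remains to see that two reduced words of the same element inside a block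
    differ by commutations only (block_comm_equiv); this is where braidlessness
    enters.  Let [S] be the set of the [al (e j)] with [k <= j], and [omega] the
    fundamental weight of [al (e k)] for [S].  A positive root of lead
    [k] pairs positively with [omega].  The letters [i] of the block satisfy
    [v (al i) \in S] (tail_letters), hence if [i] and [j] can both follow
    [v x] inside the block, then [v (al i)] and [v (al j)] are in [S] and pair
    positively with a conjugate of [omega] under the group generated by [S],
    so they are orthogonal (block_orth).  Commutation equivalence follows by
    induction on the length, using the exchange condition. *)

(** * Scalar product and reflections *)

Section Reflections.
Variables (R : realType) (n : nat).
Local Notation V := 'rV[R]_n.
Implicit Types (a b u v : V) (c : R) (s : seq V).

Lemma dotE u v : dot u v = \sum_i u 0 i * v 0 i.
Proof. by rewrite /dot mxE; apply: eq_bigr => i _; rewrite mxE. Qed.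

Lemma dotC u v : dot u v = dot v u.
Proof. by rewrite !dotE; apply: eq_bigr => i _; rewrite mulrC. Qed.

Lemma dotDr u v w : dot u (v + w) = dot u v + dot u w.
Proof. by rewrite /dot linearD mulmxDr mxE. Qed.

Lemma dotZr u c v : dot u (c *: v) = c * dot u v.
Proof. by rewrite /dot linearZ -scalemxAr mxE. Qed.

Lemma dotNr u v : dot u (- v) = - dot u v.
Proof. by rewrite -scaleN1r dotZr mulN1r. Qed.

Lemma dotDl u v w : dot (u + v) w = dot u w + dot v w.
Proof. by rewrite dotC dotDr !(dotC w). Qed.

Lemma dotZl u c v : dot (c *: u) v = c * dot u v.
Proof. by rewrite dotC dotZr dotC. Qed.

Lemma dotNl u v : dot (- u) v = - dot u v.
Proof. by rewrite dotC dotNr dotC. Qed.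

Lemma dot_suml (I : finType) (F : I -> V) v :
  dot (\sum_i F i) v = \sum_i dot (F i) v.
Proof. by rewrite /dot mulmx_suml summxE. Qed.

Lemma dot_ge0 v : 0 <= dot v v.
Proof. by rewrite dotE sumr_ge0 // => i _; rewrite -expr2 sqr_ge0. Qed.

Lemma dot_eq0 v : (dot v v == 0) = (v == 0).
Proof.
apply/idP/eqP => [|->]; last by rewrite -(scale0r 0) dotZl mul0r.
rewrite dotE psumr_eq0 => [/allP h|i _]; last by rewrite -expr2 sqr_ge0.
apply/rowP=> i; rewrite mxE; apply/eqP.
by have := h i (mem_index_enum i); rewrite /= mulf_eq0 orbb.
Qed.

Lemma refl_is_linear a : linear (refl a).
Proof.
move=> c u v; apply/rowP=> i; rewrite /refl /copair dotDr dotZr !mxE; ring.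
Qed.

Lemma refls_is_linear s : linear (refls s).
Proof.
elim: s => [|a s IHs] c u v //=.
by rewrite [refls s _]IHs refl_is_linear.
Qed.

HB.instance Definition _ a :=
  GRing.isLinear.Build R V V *:%R (refl a) (refl_is_linear a).
HB.instance Definition _ s :=
  GRing.isLinear.Build R V V *:%R (refls s) (refls_is_linear s).

Lemma refl_self a : refl a a = - a.
Proof.
have [->|a0] := eqVneq a 0; first by rewrite linear0 oppr0.
rewrite /refl /copair mulfK ?dot_eq0 //.
by rewrite scaler_nat mulr2n opprD addrA subrr add0r.
Qed.

Lemma reflK a : involutive (refl a).
Proof.
move=> v; rewrite {2}/refl linearB linearZ /= refl_self /refl scalerN opprK.
by rewrite subrK.
Qed.

Lemma refl_orth a v : dot a v = 0 -> refl a v = v.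
Proof. by move=> h; rewrite /refl /copair h mulr0 mul0r scale0r subr0. Qed.

Lemma dot_refl a u v : dot (refl a u) (refl a v) = dot u v.
Proof.
have [->|a0] := eqVneq a 0; first by rewrite /refl !scaler0 !subr0.
have d0 : dot a a != 0 by rewrite dot_eq0.
rewrite /refl /copair !(dotDl, dotDr, dotNl, dotNr, dotZl, dotZr) (dotC u a).
by field.
Qed.

Lemma dot_refls s u v : dot (refls s u) (refls s v) = dot u v.
Proof. by elim: s u v => //= a s IHs u v; rewrite dot_refl IHs. Qed.

Lemma refls_cat s1 s2 v : refls (s1 ++ s2) v = refls s1 (refls s2 v).
Proof. by rewrite /refls foldr_cat. Qed.

Lemma refls_revK s : cancel (refls s) (refls (rev s)).
Proof.
elim: s => //= a s IHs v.
by rewrite rev_cons -cats1 refls_cat /= reflK IHs.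
Qed.

Lemma reflsK s : cancel (refls (rev s)) (refls s).
Proof. by move=> v; rewrite -{1}(revK s) refls_revK. Qed.

Lemma refls_refl s a v : refls s (refl a v) = refl (refls s a) (refls s v).
Proof. by rewrite /refl linearB linearZ /= /copair !dot_refls. Qed.

(** Conjugation: [g s_(b_1) ... s_(b_k) = s_(g b_1) ... s_(g b_k) g]. *)
Lemma refls_conj s t v :
  refls s (refls t v) = refls [seq refls s b | b <- t] (refls s v).
Proof. by elim: t => //= b t IHt; rewrite refls_refl IHt. Qed.

Lemma refls_span s t v :
  {subset t <= <<s>>%VS} -> v \in <<s>>%VS -> refls t v \in <<s>>%VS.
Proof.
move=> sts vs; elim: t sts => //= a t IHt sts.
apply: memvB; last by rewrite memvZ ?sts ?mem_head.
by apply: IHt => b bt; rewrite sts // inE bt orbT.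
Qed.

Lemma copair_eq0 a b : a != 0 -> copair a b = 0 -> dot a b = 0.
Proof.
rewrite -dot_eq0 => a0 /eqP.
by rewrite /copair !mulf_eq0 invr_eq0 (negPf a0) pnatr_eq0 /= orbF => /eqP.
Qed.

Lemma copair_gt0 a b : a != 0 -> (0 < copair a b) = (0 < dot a b).
Proof.
move=> a0; have d0 : 0 < dot a a by rewrite lt_def dot_eq0 a0 dot_ge0.
by rewrite /copair pmulr_lgt0 ?invr_gt0 // pmulr_rgt0.
Qed.

(** Fundamental weights exist for any linearly independent family [S]: the Gram
    matrix of [S] is invertible. *)
Lemma fund_weight_exists (S : seq V) a :
  free S -> a \in S -> exists omega, is_fund_weight S a omega.
Proof.
move=> fS aS; pose m := size S.
pose M : 'M[R]_(m, n) := \matrix_(i < m) S`_i.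
have S0 i : (i < m)%N -> S`_i != 0.
  by move=> im; apply: (free_not0 fS); exact: mem_nth.
have uM (u : 'rV_m) : u *m M = \sum_i u 0 i *: S`_i.
  by rewrite mulmx_sum_row; apply: eq_bigr => i _; rewrite rowK.
have Ginj (u : 'rV_m) : u *m (M *m M^T) = 0 -> u = 0.
  move=> h; have /eqP : dot (u *m M) (u *m M) = 0.
    by rewrite /dot trmx_mul mulmxA -(mulmxA u) h mul0mx mxE.
  rewrite dot_eq0 uM => /eqP /(@freeP _ _ _ (in_tuple S) fS (fun i => u 0 i)) z.
  by apply/rowP=> i; rewrite z mxE.
have Gu : M *m M^T \in unitmx.
  rewrite -row_free_unit -kermx_eq0; apply/eqP/row_matrixP=> i.
  rewrite row0; apply: Ginj; apply/sub_kermxP; exact: row_sub.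
pose t : 'rV[R]_m := \row_i (dot S`_i S`_i / 2 * (S`_i == a)%:R).
exists (t *m invmx (M *m M^T) *m M); split.
  rewrite uM memv_suml // => i _; apply: memvZ; apply: memv_span.
  exact: mem_nth.
move=> c cS; have ic : (index c S < m)%N by rewrite index_mem.
have Ec : S`_(Ordinal ic) = c by exact: nth_index.
have d0 : dot c c != 0 by rewrite dot_eq0 -Ec S0.
have : (t *m invmx (M *m M^T) *m M *m M^T) 0 (Ordinal ic) = t 0 (Ordinal ic).
  by rewrite -[in LHS]mulmxA mulmxKV.
have E : forall u : V, (u *m M^T) 0 (Ordinal ic) = dot c u.
  move=> u; rewrite mxE dotE; apply: eq_bigr => j _.
  by rewrite !mxE mulrC [S`__]Ec.
rewrite E mxE Ec /copair => ->.
by field.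
Qed.

End Reflections.

(** * Positive roots and reduced words *)

Section Words.
Variables (R : realType) (n : nat) (Phi : seq 'rV[R]_n) (Delta : n.-tuple 'rV[R]_n).
Hypotheses (rootP : root_system Phi) (baseP : is_base Delta Phi).
Local Notation V := 'rV[R]_n.
Local Notation al i := (tnth Delta i).
Local Notation weyl := (weyl Delta).
Local Notation betas := (betas Delta).
Local Notation reduced := (reduced Delta).
Local Notation Pos := (pos_roots Delta Phi).
Implicit Types (b c v : V) (i j : 'I_n) (p q r w : seq 'I_n).

HB.instance Definition _ w :=
  GRing.isLinear.Build R V V *:%R (weyl w) (@refls_is_linear R n _).

Lemma Delta_free : free Delta.
Proof. by case: baseP => /basis_free. Qed.

Lemma coordK v : v = \sum_i coord Delta i v *: al i.
Proof.
have [hb _ _] := baseP; rewrite {1}(coord_basis hb (memvf v)).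
by apply: eq_bigr => i _; rewrite (tnth_nth 0).
Qed.

Lemma coord_simple i j : coord Delta i (al j) = (i == j)%:R.
Proof. by rewrite (tnth_nth 0) coord_free ?Delta_free // eq_sym. Qed.

Lemma al_inj : injective (fun i => al i).
Proof.
move=> i j /= /(congr1 (coord Delta i)); rewrite !coord_simple eqxx.
by case: eqP => // _ /eqP; rewrite oner_eq0.
Qed.

Lemma posP b :
  reflect (b \in Phi /\ forall i, 0 <= coord Delta i b) (b \in Pos).
Proof.
rewrite mem_filter; apply: (iffP andP) => [[/forallP h1 h2]|[h1 h2]].
  by split=> // i; exact: h1.
by split=> //; apply/forallP.
Qed.

Lemma simple_root i : al i \in Phi.
Proof. by case: baseP => _ h _; rewrite h ?mem_tnth. Qed.

Lemma simple_pos i : al i \in Pos.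
Proof.
by apply/posP; split=> [|j]; rewrite ?simple_root // coord_simple ler0n.
Qed.

Lemma root_neq0 b : b \in Phi -> b != 0.
Proof. by case: rootP => _ h0 _ _ _; apply: contraTneq => ->. Qed.

Lemma weyl_root w b : b \in Phi -> weyl w b \in Phi.
Proof.
case: rootP => _ _ _ h _; elim: w => //= i w IHw bP.
by apply: h; rewrite ?simple_root ?IHw.
Qed.

Lemma root_opp b : b \in Phi -> - b \in Phi.
Proof. by move=> bP; rewrite -refl_self; case: rootP => _ _ _ h _; apply: h. Qed.

Lemma pos_or_neg b : b \in Phi -> b \in Pos \/ - b \in Pos.
Proof.
move=> bP; case: (baseP) => _ _ /(_ b bP) [p h].
have cs k : coord Delta k (\sum_i (p i)%:R *: al i) = (p k)%:R.
  rewrite linear_sum (bigD1 k) //= linearZ /= coord_simple eqxx mulr1.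
  rewrite big1 ?addr0 // => i /negPf ik.
  by rewrite linearZ /= coord_simple eq_sym ik mulr0.
case: h => eb; [left | right]; apply/posP; split; rewrite ?root_opp // => k.
  by rewrite eb cs ler0n.
by rewrite eb opprK cs ler0n.
Qed.

Lemma pos_neg b : b \in Pos -> - b \in Pos -> False.
Proof.
move=> /posP[bP b1] /posP[_ b2].
case/eqP: (root_neq0 bP); rewrite (coordK b) big1 // => i _.
suff -> : coord Delta i b = 0 by rewrite scale0r.
by apply/eqP; rewrite eq_le b1 andbT -oppr_ge0 -linearN b2.
Qed.

(** A simple root is indecomposable in the positive cone. *)
Lemma simple_indec i x b c :
    0 < x -> b \in Pos -> (forall k, 0 <= coord Delta k c) ->
  al i = x *: b + c -> b = al i.
Proof.
move=> x0 /posP[bP b0] c0 e.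
have bk k : k != i -> coord Delta k b = 0.
  move=> /negPf ki; have := congr1 (coord Delta k) e.
  rewrite coord_simple ki linearD linearZ /= => /esym/eqP.
  rewrite paddr_eq0 ?c0 ?mulr_ge0 ?b0 1?ltW // mulf_eq0 gt_eqF //=.
  by case/andP=> /eqP.
have eb : b = coord Delta i b *: al i.
  rewrite {1}(coordK b) (bigD1 i) //= big1 ?addr0 // => k /bk ->.
  by rewrite scale0r.
case: rootP => _ _ h _ _.
have [|e1|h1] := h (al i) (coord Delta i b) (simple_root i).
- by rewrite -eb.
- by rewrite eb e1 scale1r.
by have := b0 i; rewrite h1 oppr_ge0 ler10.
Qed.

(** A simple reflection permutes the positive roots other than its own. *)
Lemma refl_pos i b : b \in Pos -> b != al i -> refl (al i) b \in Pos.
Proof.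
move=> bP bi; have [bR b0] := posP _ bP.
have [//|/posP[_ h]] := @pos_or_neg (refl (al i) b) (@weyl_root [:: i] b bR).
have bk k : k != i -> coord Delta k b = 0.
  move=> /negPf ki; apply/eqP; rewrite eq_le b0 andbT -oppr_ge0.
  have := h k; rewrite linearN /refl linearB linearZ /= coord_simple ki.
  by rewrite mulr0 subr0.
have eb : b = coord Delta i b *: al i.
  rewrite {1}(coordK b) (bigD1 i) //= big1 ?addr0 // => k /bk ->.
  by rewrite scale0r.
have bi0 : coord Delta i b != 0.
  by apply: contra (root_neq0 bR) => /eqP z; rewrite eb z scale0r.
case/eqP: bi; apply: (@simple_indec i (coord Delta i b)^-1 b 0) => //.
- by rewrite invr_gt0 lt_def bi0 b0.
- by move=> k; rewrite linear0.
by rewrite addr0 [X in _ *: X]eb scalerA mulVf // scale1r.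
Qed.

Lemma weyl_cat p q v : weyl (p ++ q) v = weyl p (weyl q v).
Proof. by rewrite /Defs.weyl map_cat refls_cat. Qed.

Lemma weyl_rcons p i v : weyl (rcons p i) v = weyl p (refl (al i) v).
Proof. by rewrite -cats1 weyl_cat. Qed.

Lemma weyl_revK p : cancel (weyl p) (weyl (rev p)).
Proof. by move=> v; rewrite /Defs.weyl map_rev refls_revK. Qed.

Lemma weylK p : cancel (weyl (rev p)) (weyl p).
Proof. by move=> v; rewrite /Defs.weyl map_rev reflsK. Qed.

Lemma weyl_inj p : injective (weyl p).
Proof. exact: can_inj (weyl_revK p). Qed.

Lemma weyl_rev_eq p q : weyl p =1 weyl q -> weyl (rev p) =1 weyl (rev q).
Proof. by move=> h v; apply: (@weyl_inj p); rewrite weylK h weylK. Qed.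

Lemma weyl_cat_eq u p q w : weyl p =1 weyl q ->
  weyl (u ++ p ++ w) =1 weyl (u ++ q ++ w).
Proof. by move=> h x; rewrite !weyl_cat h. Qed.

(** Exchange condition: if [p^-1] makes the positive root [b] negative, then
    [s_b] deletes a letter of [p]. *)
Lemma exchange p b : b \in Pos -> - weyl (rev p) b \in Pos ->
  exists2 r, (size r).+1 = size p & forall v, weyl p v = refl b (weyl r v).
Proof.
elim: p b => [|i p IHp] b bP; first by move/(pos_neg bP).
rewrite rev_cons weyl_rcons => h.
have [->|bi] := eqVneq b (al i); first by exists p.
have [r sr er] := IHp _ (refl_pos bP bi) h.
exists (i :: r) => [|v] /=; first by rewrite sr.
have := er v; rewrite /Defs.weyl /= => ->.
by rewrite [LHS](refls_refl [:: al i]) /= reflK.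
Qed.

(** Exchange at the left end, for a left descent [i] of [p]. *)
Lemma left_exchange p i : - weyl (rev p) (al i) \in Pos ->
  exists2 r, (size r).+1 = size p & weyl p =1 weyl (i :: r).
Proof. exact: exchange (simple_pos i). Qed.

(** Exchange at the right end, for a right descent [i] of [p]. *)
Lemma right_exchange p i : - weyl p (al i) \in Pos ->
  exists2 r, (size r).+1 = size p & weyl p =1 weyl (rcons r i).
Proof.
rewrite -{1}(revK p) => /left_exchange[r sr er].
exists (rev r) => [|u]; first by rewrite size_rev sr size_rev.
by rewrite -rev_cons -{1}(revK p); apply: weyl_rev_eq.
Qed.

Lemma reduced_infix u p w : reduced (u ++ p ++ w) -> reduced p.
Proof.
move=> h q e; have := h (u ++ q ++ w) (weyl_cat_eq u w e).
by rewrite !size_cat leq_add2l leq_add2r.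
Qed.

Lemma reduced_prefix p q : reduced (p ++ q) -> reduced p.
Proof. exact: (@reduced_infix [::]). Qed.

Lemma reduced_suffix p q : reduced (p ++ q) -> reduced q.
Proof. by move=> h; apply: (@reduced_infix p q [::]); rewrite cats0. Qed.

Lemma reduced_eq p q :
  weyl p =1 weyl q -> (size q <= size p)%N -> reduced p -> reduced q.
Proof. by move=> e s h r er; apply: leq_trans s (h r _) => u; rewrite er e. Qed.

Lemma reduced_rev p : reduced p -> reduced (rev p).
Proof.
move=> h q e; rewrite size_rev -(size_rev q); apply: h.
by rewrite -(revK p); apply: weyl_rev_eq.
Qed.

Lemma reduced_pos p i : reduced (rcons p i) -> weyl p (al i) \in Pos.
Proof.
move=> h; case: (pos_or_neg (weyl_root p (simple_root i))) => // /right_exchange.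
case=> r sr er; have := h r _; rewrite size_rcons => h'.
suff /h' : weyl r =1 weyl (rcons p i) by lia.
by move=> u; rewrite weyl_rcons er weyl_rcons reflK.
Qed.

Lemma reduced_neg p i : reduced (i :: p) -> - weyl (rev (i :: p)) (al i) \in Pos.
Proof.
move=> /reduced_rev; rewrite rev_cons weyl_rcons refl_self linearN opprK.
exact: reduced_pos.
Qed.

Lemma betas_cat p q : betas (p ++ q) = betas p ++ [seq weyl p b | b <- betas q].
Proof.
elim: p => [|i p IHp] /=; first by rewrite map_id.
by rewrite IHp map_cat -map_comp.
Qed.

Lemma betas_rcons p i : betas (rcons p i) = rcons (betas p) (weyl p (al i)).
Proof. by rewrite -cats1 betas_cat cats1. Qed.

Lemma size_betas p : size (betas p) = size p.
Proof. by elim: p => //= i p IHp; rewrite size_map IHp. Qed.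

Lemma betas_take m p : betas (take m p) = take m (betas p).
Proof. by elim: p m => [|i p IHp] [|m] //=; rewrite IHp map_take. Qed.

Lemma betas_split p b : b \in betas p ->
  exists u i w, p = u ++ i :: w /\ b = weyl u (al i).
Proof.
elim: p b => //= i p IHp b; rewrite inE => /predU1P[->|].
  by exists [::], i, p.
case/mapP=> c /IHp[u [j [w [-> ->]]] ->].
by exists (i :: u), j, w.
Qed.

(** The roots [beta_k] of a reduced word [p] are the positive roots that
    [p^-1] makes negative. *)
Lemma betas_inv p b : reduced p -> b \in betas p ->
  b \in Pos /\ - weyl (rev p) b \in Pos.
Proof.
move=> h /betas_split[u [i [w [ep ->]]]]; rewrite ep in h *; split.
  by apply: reduced_pos; apply: (@reduced_prefix _ w); rewrite cat_rcons.
rewrite rev_cat weyl_cat weyl_revK; apply: reduced_neg.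
exact: reduced_suffix h.
Qed.

Lemma inv_betas p b : b \in Pos -> - weyl (rev p) b \in Pos -> b \in betas p.
Proof.
elim: p b => [|i p IHp] b bP; first by move/(pos_neg bP).
rewrite rev_cons weyl_rcons /= inE => h.
have [//|bi /=] := eqVneq b (al i).
apply/mapP; exists (refl (al i) b); last by rewrite reflK.
exact: IHp (refl_pos bP bi) h.
Qed.

Lemma betas_eq p q : reduced p -> weyl p =1 weyl q ->
  {subset betas p <= betas q}.
Proof.
move=> h e b /(betas_inv h)[bP]; rewrite (weyl_rev_eq e).
exact: inv_betas.
Qed.

(** * Alternating words *)

Lemma size_alt i j m : size (alt i j m) = m.
Proof. by elim: m i j => //= m IHm i j; rewrite IHm. Qed.

Lemma mem_alt i j m a : a \in alt i j m -> a \in [:: i; j].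
Proof.
elim: m i j => //= m IHm i j; rewrite inE => /predU1P[->|/IHm].
  by rewrite mem_head.
by rewrite !inE orbC.
Qed.

Lemma alt_cat i j m k :
  alt i j (m + k) = alt i j m ++ (if odd m then alt j i k else alt i j k).
Proof. by elim: m i j => //= m IHm i j; rewrite IHm; case: odd. Qed.

Lemma alt_rcons i j m : alt i j m.+1 = rcons (alt i j m) (if odd m then j else i).
Proof. by rewrite -addn1 alt_cat -cats1; case: odd. Qed.

Lemma rev_alt i j m : rev (alt i j m) = if odd m then alt i j m else alt j i m.
Proof.
elim: m i j => // m IHm i j; rewrite [LHS]rev_cons IHm !alt_rcons /=.
by case: odd.
Qed.

(** If the two alternating words of length [m] are reduced and represent the same
    element, then [m] is the order of [s_i s_j]. *)
Lemma cox_orderP i j m : (0 < m)%N -> reduced (alt i j m) ->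
  weyl (alt i j m) =1 weyl (alt j i m) -> cox_order Delta i j m.
Proof.
move=> m0 hr e; split=> // [u|m' m'0 e'].
  rewrite -addnn alt_cat weyl_cat e.
  have -> : (if odd m then alt j i m else alt i j m) = rev (alt j i m).
    by rewrite rev_alt.
  by rewrite weylK.
rewrite leqNgt; apply/negP=> lt.
(* If m' < m, then the first m' + 1 letters equal the inverse of the m' - 1
   other letters of the relation. *)
have em : m'.*2 = (m'.+1 + m'.-1)%N by rewrite -addnn; lia.
move: e'; rewrite em alt_cat; set B := (X in _ ++ X) => e'.
have hA : reduced (alt i j m'.+1).
  by move: hr; rewrite -(subnKC lt) alt_cat; apply: reduced_prefix.
have := hA (rev B) _; rewrite size_rev size_alt => h.
have sB : size B = m'.-1 by rewrite /B; case: ifP; rewrite size_alt.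
suff /h : weyl (rev B) =1 weyl (alt i j m'.+1) by rewrite sB; lia.
by move=> u; rewrite -[u in RHS](weylK B) -weyl_cat e'.
Qed.

Lemma cox_order2 i j : i != j -> dot (al i) (al j) = 0 -> cox_order Delta i j 2.
Proof.
move=> ij o; have sij u : refl (al i) (refl (al j) u) = refl (al j) (refl (al i) u).
  have := refls_refl [:: al i] (al j) u => /= ->.
  by rewrite (refl_orth o).
split=> // [u|]; first by rewrite /= /Defs.weyl /= sij !reflK.
case=> [|[|m]] // _ /(_ (al j)).
rewrite /Defs.weyl /= refl_self linearN /= (refl_orth o) => h.
by case: (pos_neg (simple_pos j)); rewrite h simple_pos.
Qed.

(** * Commutations and dihedral factors *)

(** Equivalence of words under 2-term braid moves. *)
Definition comm_equiv : seq 'I_n -> seq 'I_n -> Prop :=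
  clos_refl_trans _ (fun p q => exists k, braid_move Delta k 2 p q).

Lemma comm_equiv_allowed i u w p q : comm_equiv p q ->
  clos_refl_trans _ (allowed_move Delta i) (u ++ p ++ w) (u ++ q ++ w).
Proof.
elim=> [{}p {}q [k [u' [w' [c [d [cd o su -> ->]]]]]]|{}p|p1 p2 p3 _ h1 _ h2].
- apply: rt_step; exists (size u + k)%N, 2%N; split; last by left.
  exists (u ++ u'), (w' ++ w), c, d; split=> //.
  + by rewrite size_cat su.
  + by rewrite -!catA.
  + by rewrite -!catA.
- exact: rt_refl.
exact: rt_trans h1 h2.
Qed.

Lemma comm_equiv_cons i p q : comm_equiv p q -> comm_equiv (i :: p) (i :: q).
Proof.
elim=> [{}p {}q [k [u [w [c [d [cd o su -> ->]]]]]]|{}p|p1 p2 p3 _ h1 _ h2].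
- by apply: rt_step; exists k.+1, (i :: u), w, c, d; split; rewrite //= su.
- exact: rt_refl.
exact: rt_trans h1 h2.
Qed.

Lemma comm_equiv_swap i j p : i != j -> dot (al i) (al j) = 0 ->
  comm_equiv (i :: j :: p) (j :: i :: p).
Proof.
move=> ij o; apply: rt_step; exists 0, [::], p, i, j; split=> //.
exact: cox_order2.
Qed.

(** Words in [i] and [j] preserve the plane of [al i] and [al j]. *)
Lemma weyl_plane i j p : {subset p <= [:: i; j]} ->
  exists x y, weyl p (al i) = x *: al i + y *: al j.
Proof.
elim: p => [|c p IHp] h.
  by exists 1, 0; rewrite scale1r scale0r addr0.
have [|x [y exy]] := IHp; first by move=> d dp; apply: h; rewrite inE dp orbT.
rewrite -cat1s weyl_cat exy /Defs.weyl /= /refl.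
set m := copair _ _; have := h c (mem_head _ _); rewrite !inE => /orP[]/eqP ->.
  by exists (x - m), y; rewrite scalerBl addrAC.
by exists x, (y - m); rewrite scalerBl addrA.
Qed.

(** Every element sending [al j] to a positive root factors, with lengths adding up,
    as [y z] with [z] alternating in [i], [j] and [y] sending both [al i] and
    [al j] to positive roots. *)
Lemma dihedral_factor x i j : weyl x (al j) \in Pos ->
  exists y l, [/\ weyl x =1 weyl (y ++ rev (alt i j l)), size x = (size y + l)%N,
    weyl y (al i) \in Pos & weyl y (al j) \in Pos].
Proof.
move: {2}(size x) (erefl (size x)) => N; elim: N x i j => [|N IHN] x i j sx xj.
  by exists x, 0; case: x sx xj => // _ _; rewrite !simple_pos.
case: (pos_or_neg (weyl_root x (simple_root i))) => xi.
  by exists x, 0; rewrite cats0 addn0.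
have [x' sx' ex'] := right_exchange xi.
have x'i : weyl x' (al i) \in Pos.
  by move: xi; rewrite ex' weyl_rcons refl_self linearN opprK.
have [|y [l [ey sy yj yi]]] := IHN x' j i _ x'i; first by lia.
exists y, l.+1; split=> //; last by lia.
move=> u; rewrite ex' weyl_rcons ey /= rev_cons -cats1 catA.
by rewrite [RHS]weyl_cat.
Qed.

End Words.

(** * The blocks of the order *)

Section Blocks.
Variables (R : realType) (n : nat) (Phi : seq 'rV[R]_n) (Delta : n.-tuple 'rV[R]_n).
Hypotheses (rootP : root_system Phi) (baseP : is_base Delta Phi).
Variable e : 'S_n.
Local Notation V := 'rV[R]_n.
Local Notation al i := (tnth Delta i).
Local Notation weyl := (weyl Delta).
Local Notation betas := (betas Delta).
Local Notation reduced := (reduced Delta).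
Local Notation Pos := (pos_roots Delta Phi).
Local Notation lead := (lead Delta e).
Local Notation comm_equiv := (comm_equiv Delta).
Implicit Types (b c v : V) (i j : 'I_n) (p q r w : seq 'I_n).

Lemma size_coefs b : size (coefs Delta e b) = n.
Proof. by rewrite size_map size_enum_ord. Qed.

Lemma nth_coefs b (j : 'I_n) : (coefs Delta e b)`_j = coord Delta (e j) b.
Proof. by rewrite (nth_map j) ?size_enum_ord // nth_ord_enum. Qed.

Lemma lead_geP k b : (k <= n)%N ->
  (k <= lead b)%N <-> (forall j, (j < k)%N -> coord Delta (e j) b = 0).
Proof.
move=> kn; split=> [h j jk|h].
  have := @before_find _ 0 (fun x => x != 0) (coefs Delta e b) j (leq_trans jk h).
  by rewrite nth_coefs => /negbFE/eqP.
rewrite leqNgt; apply/negP=> lt; have ltn := leq_trans lt kn.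
have := @nth_find _ 0 (fun x => x != 0) (coefs Delta e b).
rewrite has_find size_coefs => /(_ ltn).
by rewrite -/(Defs.lead Delta e b) (nth_coefs b (Ordinal ltn)) h ?eqxx.
Qed.

Lemma lead_neq0 (k : 'I_n) b : lead b = k -> coord Delta (e k) b != 0.
Proof.
move=> h; have := @nth_find _ 0 (fun x => x != 0) (coefs Delta e b).
by rewrite has_find size_coefs -/(Defs.lead Delta e b) h nth_coefs => ->.
Qed.

Lemma lead_simple (k : 'I_n) : lead (al (e k)) = k.
Proof.
apply/eqP; rewrite eqn_leq; apply/andP; split; last first.
  apply/lead_geP => [|j jk]; first exact: ltnW.
  rewrite (coord_simple baseP) (inj_eq perm_inj).
  by case: eqP jk => // ->; rewrite ltnn.
rewrite leqNgt; apply/negP=> /(@lead_geP k.+1 _ (ltn_ord k)) /(_ k (ltnSn k)).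
by rewrite (coord_simple baseP) eqxx => /eqP; rewrite oner_eq0.
Qed.

(** The simple roots [al (e j)], [k <= j]. *)
Definition tail_base (k : 'I_n) : seq V :=
  [seq al (e j) | j : 'I_n <- enum 'I_n & (k <= j)%N].

Section Block.
Variable k : 'I_n.
Local Notation S := (tail_base k).

Lemma mem_tail_base j : (al (e j) \in S) = (k <= j)%N.
Proof.
rewrite /tail_base (@mem_map _ _ (fun j => al (e j))) => [|i i'].
  by rewrite mem_filter mem_enum andbT.
by move/(al_inj baseP)/perm_inj.
Qed.

Lemma tail_baseP b : reflect (exists2 j : 'I_n, (k <= j)%N & b = al (e j)) (b \in S).
Proof.
apply: (iffP mapP) => [[j]|[j kj ->]].
  by rewrite mem_filter => /andP[kj _] ->; exists j.
by exists j; rewrite // mem_filter kj mem_enum.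
Qed.

Lemma tail_base_free : free S.
Proof.
have uD := free_uniq (Delta_free baseP).
rewrite -(@perm_free _ _ [seq b <- Delta | b \in S]).
  exact: filter_free (Delta_free baseP).
apply: uniq_perm; first exact: filter_uniq.
  rewrite map_inj_uniq => [|i i']; first by apply: filter_uniq; exact: enum_uniq.
  by move/(al_inj baseP)/perm_inj.
move=> b; rewrite mem_filter; case: (boolP (b \in S)) => //= /tail_baseP[j _ ->].
by rewrite mem_tnth.
Qed.

Lemma span_tailP b : reflect (k <= lead b)%N (b \in <<S>>%VS).
Proof.
apply: (iffP idP) => h.
  apply/lead_geP => [|j jk]; first exact: ltnW.
  have : (<<S>> <= lker (linfun (coord Delta (e j) : V -> R^o)))%VS.
    apply/span_subvP => c /tail_baseP[i ki ->].
    rewrite memv_ker lfunE /= (coord_simple baseP) (inj_eq perm_inj).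
    by have [ji|] := eqVneq j i; [move: jk; rewrite ji ltnNge ki | rewrite eqxx].
  by move/subvP/(_ _ h); rewrite memv_ker lfunE /= => /eqP.
rewrite (coordK baseP b) (reindex_inj (@perm_inj _ e)) memv_suml // => j _.
have [kj|jk] := leqP k j; first by rewrite memvZ ?memv_span ?mem_tail_base.
by move/lead_geP: h => -> //; rewrite ?scale0r ?mem0v // ltnW.
Qed.

(** Only the coefficient of [al (e k)] contributes to the product of [b] with
    the fundamental weight of [al (e k)]. *)
Lemma lead_dot b omega : b \in Pos -> lead b = k ->
  is_fund_weight S (al (e k)) omega -> 0 < dot b omega.
Proof.
move=> /(posP) [_ b0] lb [_ h].
have a0 i : al i != 0 by exact: (root_neq0 rootP (simple_root baseP i)).
rewrite (coordK baseP b) dot_suml (bigD1 (e k)) //= dotZl big1 => [|i ik].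
  rewrite addr0 mulr_gt0 //; first by rewrite lt_def b0 lead_neq0.
  by rewrite -copair_gt0 // h ?mem_tail_base // eqxx.
rewrite dotZl -(permKV e i); set j := (e^-1)%g i.
have [kj|jk] := leqP k j.
  rewrite (copair_eq0 (a0 _)) ?mulr0 // h ?mem_tail_base //.
  by rewrite (inj_eq (al_inj baseP)) permKV (negPf ik).
have /lead_geP -> // : (k <= lead b)%N by rewrite lb.
  by rewrite mul0r.
exact: ltnW.
Qed.

(** The product of the blocks before the [k]-th one: [v] is a reduced word whose
    roots are the positive roots of lead less than [k]. *)
Variable v : seq 'I_n.
Hypothesis v_red : reduced v.
Hypothesis v_betas : forall b, b \in Pos -> (b \in betas v) = (lead b < k)%N.

(** [v] sends no positive root to a negative root of the span of [S]: its opposite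
    would be an inversion of [v] of lead at least [k]. *)
Lemma weyl_tail_pos c : c \in Pos -> weyl v c \in <<S>>%VS -> weyl v c \in Pos.
Proof.
move=> cP /span_tailP cS; have cR := (posP _ _ _ cP).1.
case: (pos_or_neg rootP baseP (weyl_root rootP baseP v cR)) => // h.
have : - weyl v c \in betas v.
  by apply: (inv_betas rootP baseP h); rewrite linearN /= opprK weyl_revK.
rewrite v_betas // ltnNge; case/negP.
apply/span_tailP; rewrite memvN; exact/span_tailP.
Qed.

Lemma weyl_rev_tail_pos b : b \in Pos -> (k <= lead b)%N -> weyl (rev v) b \in Pos.
Proof.
move=> bP kb; have bR := (posP _ _ _ bP).1.
case: (pos_or_neg rootP baseP (weyl_root rootP baseP (rev v) bR)) => // h.
have := inv_betas rootP baseP bP h.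
by rewrite v_betas // ltnNge kb.
Qed.

(** If [v (al i)] lies in the span of [S], then it is an element of [S]: the
    inverse of [v] turns its expansion on [S] into an expansion of the
    indecomposable [al i] on positive roots. *)
Lemma weyl_simple_tail i : weyl v (al i) \in <<S>>%VS -> weyl v (al i) \in S.
Proof.
move=> iS; have bP := weyl_tail_pos (simple_pos baseP i) iS.
set b := weyl v (al i) in iS bP *; have [bR b0] := posP _ _ _ bP.
have kb : (k <= lead b)%N by apply/span_tailP.
have bj (j : 'I_n) : (j < k)%N -> coord Delta (e j) b = 0.
  exact: ((lead_geP b (ltnW (ltn_ord k))).1 kb).
have [/existsP[j bj0]|/existsPn b00] :=
  boolP [exists j, coord Delta (e j) b != 0]; last first.
  case/eqP: (root_neq0 rootP bR); rewrite (coordK baseP b).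
  rewrite (reindex_inj (@perm_inj _ e)) big1 // => j _.
  by have := b00 j; rewrite negbK => /eqP ->; rewrite scale0r.
have kj : (k <= j)%N by rewrite leqNgt; apply: contra bj0 => /bj ->.
pose g (j : 'I_n) := weyl (rev v) (al (e j)).
have gP j' : (k <= j')%N -> g j' \in Pos.
  move=> kj'; apply: weyl_rev_tail_pos; first exact: simple_pos.
  by rewrite lead_simple.
suff gj : g j = al i by rewrite /b -gj weylK mem_tail_base.
apply: (@simple_indec _ _ _ _ rootP baseP i (coord Delta (e j) b) _
   (\sum_(j' | j' != j) coord Delta (e j') b *: g j')).
- by rewrite lt_def bj0 b0.
- exact: gP.
- move=> l; rewrite linear_sum sumr_ge0 // => j' _; rewrite linearZ /=.
  have [/gP/posP[_ gl]|/bj ->] := leqP k j'; last by rewrite mul0r.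
  by rewrite mulr_ge0.
rewrite -(weyl_revK Delta v (al i)) -/b {1}(coordK baseP b).
rewrite (reindex_inj (@perm_inj _ e)) linear_sum (bigD1 j) //= linearZ.
by congr (_ + _); apply: eq_bigr => j' _; rewrite linearZ.
Qed.

(** A letter that extends [v ++ p] to a reduced word contributes a root outside
    the inversions of [v]. *)
Lemma block_root p i : reduced (v ++ rcons p i) ->
  weyl (v ++ p) (al i) \in Pos /\ (k <= lead (weyl (v ++ p) (al i)))%N.
Proof.
move=> h; have bP : weyl (v ++ p) (al i) \in Pos.
  by apply: (reduced_pos rootP baseP); rewrite rcons_cat.
split=> //; rewrite leqNgt -v_betas //.
apply/negP => /(betas_inv rootP baseP v_red) [_].
rewrite weyl_cat weyl_revK; apply: pos_neg => //.
exact: (reduced_pos rootP baseP (reduced_suffix h)).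
Qed.

Lemma tail_letters_conj p u : weyl (v ++ p) u =
  refls [seq weyl v (al i) | i <- p] (weyl v u).
Proof. by rewrite weyl_cat [LHS]refls_conj -map_comp. Qed.

(** Every letter of a reduced continuation of [v] corresponds to an element of
    [S]. *)
Lemma tail_letters p : reduced (v ++ p) -> {in p, forall i, weyl v (al i) \in S}.
Proof.
elim/last_ind: p => // p i IHp h; have [_ kb] := block_root h.
have {}IHp : {in p, forall j, weyl v (al j) \in S}.
  by apply: IHp; move: h; rewrite -cats1 catA; apply: reduced_prefix.
move=> j; rewrite mem_rcons inE => /predU1P[->|]; last exact: IHp.
apply: weyl_simple_tail; set t := [seq weyl v (al i) | i <- p].
rewrite -(refls_revK t (weyl v (al i))) -tail_letters_conj.
apply: refls_span; last exact/span_tailP.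
by move=> b; rewrite mem_rev => /mapP[l lp ->]; rewrite memv_span ?IHp.
Qed.

Lemma tail_weyl_pos p i : reduced (v ++ p) -> weyl v (al i) \in S ->
  weyl p (al i) \in Pos -> weyl (v ++ p) (al i) \in Pos.
Proof.
move=> h iS pi; rewrite weyl_cat; apply: weyl_tail_pos => //.
rewrite -weyl_cat tail_letters_conj refls_span ?memv_span //.
by move=> b /mapP[l lp ->]; rewrite memv_span ?(tail_letters h).
Qed.

Hypothesis k_braidless : braidless S (al (e k)).

(** Two letters that can follow [v ++ x] inside the block of lead [k] commute:
    both simple roots pair positively with the weight [(v x)^-1 omega]. *)
Lemma block_orth x i j : i != j ->
    reduced (v ++ rcons x i) -> reduced (v ++ rcons x j) ->
    lead (weyl (v ++ x) (al i)) = k -> lead (weyl (v ++ x) (al j)) = k ->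
  dot (al i) (al j) = 0.
Proof.
move=> ij hi hj ki kj; have [omega omegaP] := fund_weight_exists tail_base_free
  (etrans (mem_tail_base k) (leqnn k)).
set t := [seq weyl v (al l) | l <- x].
have tS : {subset rev t <= S}.
  move=> b; rewrite mem_rev => /mapP[l lx ->]; apply: (tail_letters hi) => //.
  by rewrite mem_rcons inE lx orbT.
have iS : weyl v (al i) \in S by apply: (tail_letters hi); rewrite mem_rcons mem_head.
have jS : weyl v (al j) \in S by apply: (tail_letters hj); rewrite mem_rcons mem_head.
have a0 l : weyl v (al l) != 0.
  exact: (root_neq0 rootP (weyl_root rootP baseP v (simple_root baseP l))).
have pos l : reduced (v ++ rcons x l) -> lead (weyl (v ++ x) (al l)) = k ->
    0 < copair (weyl v (al l)) (refls (rev t) omega).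
  move=> hl kl; rewrite copair_gt0 // -(refls_revK t (weyl v (al l))) dot_refls.
  rewrite -tail_letters_conj; apply: lead_dot omegaP => //.
  by case: (block_root hl).
rewrite -(dot_refls [seq al l | l <- v]) (copair_eq0 (a0 i)) //.
apply: (k_braidless omegaP tS) => //; try exact: pos.
by rewrite (inj_eq (@weyl_inj _ _ Delta v)) (inj_eq (al_inj baseP)).
Qed.

(** Full commutativity: inside a block, after a common prefix [v ++ x], two
    reduced words of the same element differ by commutations only. *)
Lemma block_comm_equiv p q x : reduced (v ++ x ++ p) -> size q = size p ->
    weyl p =1 weyl q ->
    (forall b, b \in betas (v ++ x ++ p) -> (lead b <= k)%N) ->
  comm_equiv p q.
Proof.
move: {2}(size p) (erefl (size p)) => N; elim: N p q x => [|N IHN] p q x sp hr sq epq hl.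
  by case: p q sp sq {hr epq hl} => // -[] // _ _; exact: rt_refl.
case: p q sp sq hr epq hl => // i p [|j q] // [sp] [sq] hr epq hl.
have hr' : reduced (v ++ x ++ j :: q).
  apply: reduced_eq hr; first by move=> u; rewrite !weyl_cat epq.
  by rewrite !size_cat /= sq.
have cat3 y l s : v ++ y ++ l :: s = (v ++ rcons y l) ++ s by rewrite -cats1 -!catA.
have [eij|ij] := eqVneq i j.
  rewrite -eij; apply: comm_equiv_cons; apply: (IHN _ _ (rcons x i)) => //.
  - by move: hr; rewrite cat_rcons.
  - move=> u; have := epq u; rewrite -eij; exact: (can_inj (reflK (al i))).
  - by rewrite cat_rcons.
have step l s : reduced (v ++ x ++ l :: s) -> weyl (i :: p) =1 weyl (l :: s) ->
    reduced (v ++ rcons x l) /\ lead (weyl (v ++ x) (al l)) = k.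
  move=> h el; have hx : reduced (v ++ rcons x l).
    by move: h; rewrite cat3; apply: reduced_prefix.
  split=> //; apply/eqP; rewrite eqn_leq; have [_ ->] := block_root hx; rewrite andbT.
  apply: hl; apply: (betas_eq rootP baseP h).
    by move=> u; rewrite !weyl_cat el.
  by rewrite cat3 betas_cat -rcons_cat betas_rcons mem_cat mem_rcons mem_head.
have [hi ki] := step _ _ hr (fun=> erefl).
have [hj kj] := step _ _ hr' epq.
have oij := block_orth ij hi hj ki kj.
have hjq : reduced (j :: q) := reduced_suffix (reduced_suffix hr').
(* Since [i] and [j] commute, [j] is also a left descent of [p]. *)
have [r sr er] : exists2 r, (size r).+1 = size p & weyl p =1 weyl (j :: r).
  apply: (left_exchange rootP baseP).
  have := reduced_neg rootP baseP hjq.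
  rewrite -(weyl_rev_eq epq) rev_cons weyl_rcons refl_orth //.
have eq_r : weyl q =1 weyl (i :: r).
  move=> u; apply: (can_inj (reflK (al j))).
  have := epq u; rewrite /Defs.weyl /= => <-.
  have := er u; rewrite /Defs.weyl /= => ->.
  have := refls_refl [:: al i] (al j) (refls [seq al l | l <- r] u) => /= ->.
  by rewrite (refl_orth oij).
have ejr : weyl (j :: q) =1 weyl (j :: i :: r).
  by move=> u; exact: (congr1 (refl (al j)) (eq_r u)).
have hr2 : reduced (v ++ x ++ j :: i :: r).
  apply: reduced_eq hr' => [u|]; first by rewrite !weyl_cat ejr.
  by rewrite !size_cat /=; lia.
apply: rt_trans (_ : comm_equiv (i :: j :: r) _).
  by apply: comm_equiv_cons; apply: (IHN _ _ (rcons x i)); rewrite ?cat_rcons.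
apply: rt_trans (comm_equiv_swap rootP baseP r ij oij) _.
apply: comm_equiv_cons; apply: (IHN _ _ (rcons x j)); rewrite ?cat_rcons //=.
- by lia.
- by lia.
move=> b hb; apply: hl; apply: (betas_eq rootP baseP hr2) hb => u.
by rewrite !weyl_cat -ejr epq.
Qed.

(** A word [v ++ x ++ [:: i]] whose last root is a simple root [al i0], [x]
    filling roots of lead [k], can be transformed by allowed moves so that
    [al i0] comes immediately after [v].  Write [x = y z], where [z] is
    alternating in [i] and the last letter [j] of [x]; then [z i] is the longest
    element of the dihedral group of [i] and [j], and one braid move on it
    brings [al i0] in front of [z]. *)
Lemma block_pass i0 x i w : reduced (v ++ rcons x i) ->
    (forall b, b \in betas (v ++ x) -> (lead b <= k)%N) ->
    weyl (v ++ x) (al i) = al i0 ->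
  exists j x', [/\ reduced (rcons v j), weyl v (al j) = al i0 &
    clos_refl_trans _ (allowed_move Delta i0)
      (v ++ x ++ i :: w) (v ++ j :: x' ++ w)].
Proof.
move: {2}(size x) (leqnn (size x)) => N; elim: N x i w => [|N IHN] x i w.
  case: x => // _ h _ e0; exists i, [::]; split=> //.
  - by rewrite -(cats1 v).
  - by rewrite -e0 cats0.
  exact: rt_refl.
case/lastP: x => [|x j] sx hr hl e0.
  exact: (IHN [::] i w).
set x1 := rcons x j in hr hl e0 *.
have hx1i : reduced (rcons x1 i) := reduced_suffix hr.
have hx1 : reduced x1 by move: hx1i; rewrite -cats1; apply: reduced_prefix.
have hvx1 : reduced (v ++ x1).
  by move: hr; rewrite -cats1 catA; apply: reduced_prefix.
have Lx : {in rcons x1 i, forall l, weyl v (al l) \in S} := tail_letters hr.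
have ji : j != i.
  apply/eqP=> eji; have := hx1i x _; rewrite !size_rcons => h.
  suff /h : weyl x =1 weyl (rcons x1 i) by lia.
  by move=> u; rewrite !weyl_rcons eji reflK.
have x1i : weyl x1 (al i) \in Pos := reduced_pos rootP baseP hx1i.
have [y [l [ey sy yj yi]]] := dihedral_factor rootP baseP j x1i.
set z := rev (alt j i l) in ey.
(* [x1] ends in [j], hence sends [al j] to a negative root, unlike [y]. *)
have l0 : (0 < l)%N.
  rewrite lt0n; apply/eqP=> l0; move: ey yj; rewrite /z l0 cats0 => <-.
  rewrite weyl_rcons refl_self linearN /= => /pos_neg; apply => //.
  by rewrite opprK; exact: reduced_pos.
have sz : size z = l by rewrite size_rev size_alt.
have hyz : reduced (v ++ y ++ z).
  apply: reduced_eq hvx1 => [u|]; first by rewrite !weyl_cat ey weyl_cat.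
  by rewrite !size_cat sz sy.
have moveA : comm_equiv x1 (y ++ z).
  by apply: (block_comm_equiv (x := [::])) => //; rewrite size_cat sz.
have hvy : reduced (v ++ y) by move: hyz; rewrite catA; apply: reduced_prefix.
have jS : weyl v (al j) \in S by apply: Lx; rewrite !(mem_rcons, inE) eqxx orbT.
have iS : weyl v (al i) \in S by apply: Lx; rewrite mem_rcons mem_head.
have vyj := tail_weyl_pos hvy jS yj.
have vyi := tail_weyl_pos hvy iS yi.
have ezi : weyl (v ++ y) (weyl z (al i)) = al i0.
  by rewrite -weyl_cat -catA !(weyl_cat Delta v) -ey -weyl_cat.
(* [al i0] is a combination of the positive roots [v y (al i)] and
   [v y (al j)], so it is one of them. *)
have [c cij ezc] : exists2 a, a \in [:: i; j] & weyl z (al i) = al a.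
  have zij : {subset z <= [:: i; j]}.
    by move=> c; rewrite mem_rev => /mem_alt; rewrite !inE orbC.
  have [p [q epq]] := weyl_plane Delta zij.
  have {}ezi : al i0 = p *: weyl (v ++ y) (al i) + q *: weyl (v ++ y) (al j).
    by rewrite -ezi epq linearD !linearZ.
  have [_ vyi0] := posP _ _ _ vyi; have [_ vyj0] := posP _ _ _ vyj.
  have cp : coord Delta i (weyl z (al i)) = p.
    rewrite epq linearD !linearZ /= !(coord_simple baseP) eqxx eq_sym (negPf ji).
    by rewrite mulr0 addr0 mulr1.
  have cq : coord Delta j (weyl z (al i)) = q.
    rewrite epq linearD !linearZ /= !(coord_simple baseP) eqxx (negPf ji).
    by rewrite mulr0 add0r mulr1.
  have ci0 : 1 = p * coord Delta i0 (weyl (v ++ y) (al i))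
               + q * coord Delta i0 (weyl (v ++ y) (al j)).
    have := congr1 (coord Delta i0) ezi.
    by rewrite linearD !linearZ /= (coord_simple baseP) eqxx.
  have found a : al i0 = weyl (v ++ y) (al a) -> weyl z (al i) = al a.
    move=> ec; apply: (@weyl_inj _ _ Delta (v ++ y)).
    by rewrite -ec ezi epq linearD !linearZ.
  have [/posP[_ pos]|/posP[_ neg]] :=
    pos_or_neg rootP baseP (weyl_root rootP baseP z (simple_root baseP i)).
    have p0 : 0 <= p by rewrite -cp.
    have q0 : 0 <= q by rewrite -cq.
    have [p1|p1] := ltP 0 p.
      exists i; rewrite ?mem_head //; apply: found; apply/esym.
      apply: (simple_indec rootP baseP p1 vyi _ ezi) => k'.
      by rewrite linearZ /= mulr_ge0.
    have {p1 p0} p0 : p = 0 by apply/eqP; rewrite eq_le p1.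
    exists j; rewrite ?inE ?eqxx ?orbT //; apply: found; apply/esym.
    have q1 : 0 < q.
      rewrite lt_def q0 andbT; apply: contra_eq_neq ci0 => ->.
      by rewrite p0 !mul0r addr0 oner_eq0.
    apply: (simple_indec (c := 0) rootP baseP q1 vyj) => [k'|].
      by rewrite linear0.
    by rewrite ezi p0 scale0r add0r addr0.
  have p0 : p <= 0 by have := neg i; rewrite linearN /= cp oppr_ge0.
  have q0 : q <= 0 by have := neg j; rewrite linearN /= cq oppr_ge0.
  have : (1 : R) <= 0 by rewrite ci0 -oppr_ge0 opprD addr_ge0 // oppr_ge0 mulr_le0_ge0.
  by rewrite ler10.
(* Read from the left, [z i] alternates starting with [d]. *)
pose d := if odd l then j else i; pose d' := if odd l then i else j.
have ez : z = alt d d' l by rewrite /z rev_alt /d /d'; case: odd.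
have ezr : rcons z i = alt d d' l.+1.
  by rewrite alt_rcons -ez /d /d'; case: odd.
have hyzi : reduced (v ++ y ++ rcons z i).
  apply: reduced_eq hr => [u|].
    by rewrite !weyl_cat (weyl_rcons Delta x1) (weyl_rcons Delta z) ey weyl_cat.
  by rewrite !size_cat (size_rcons x1) (size_rcons z) sz sy; lia.
have eref u : weyl (rcons z i) u = refl (al c) (weyl z u).
  by rewrite weyl_rcons [LHS]refls_refl -ezc.
have dd' : d != d' by rewrite /d /d'; case: odd; rewrite // eq_sym.
(* If [c = d], then [z s_i = s_d z] cancels the first letter of [z], and the
   word [v ++ y ++ rcons z i] is not reduced. *)
have ec : c = d'.
  apply/eqP; apply: contraT => cd.
  have {}cd : c = d.
    by move: cij cd; rewrite !inE /d /d'; case: odd => /orP[]/eqP -> //; rewrite eqxx.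
  have := hyzi (v ++ y ++ alt d' d l.-1) _; rewrite !size_cat size_rcons sz size_alt.
  move=> h.
  suff /h : weyl (v ++ y ++ alt d' d l.-1) =1 weyl (v ++ y ++ rcons z i) by lia.
  move=> u; rewrite !weyl_cat eref cd ez -(prednK l0).
  by rewrite [alt d d' l.-1.+1]/= /Defs.weyl /= reflK.
have ed : weyl (alt d d' l.+1) =1 weyl (alt d' d l.+1).
  by move=> u; rewrite -ezr eref ez ec.
have cox : cox_order Delta d d' l.+1.
  apply: cox_orderP => //; rewrite -ezr.
  exact: (reduced_suffix (reduced_suffix hyzi)).
have hyd : reduced (v ++ rcons y d').
  apply: (@reduced_prefix _ _ _ _ (alt d d' l)); rewrite -catA cat_rcons.
  apply: reduced_eq hyzi => [u|].
    by rewrite ezr !weyl_cat ed.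
  by rewrite !size_cat /= size_alt size_rcons sz.
have hly b : b \in betas (v ++ y) -> (lead b <= k)%N.
  move=> hb; apply: hl; apply: (betas_eq rootP baseP hyz) => [u|].
    by rewrite !weyl_cat ey weyl_cat.
  by rewrite catA betas_cat mem_cat hb.
have eyd : weyl (v ++ y) (al d') = al i0 by rewrite -ezi ezc ec.
have [|a [x' [ha ea mv]]] := IHN y d' (alt d d' l ++ w) _ hyd hly eyd.
  by move: sx; rewrite sy; lia.
exists a, (x' ++ alt d d' l); split=> //.
rewrite -catA; apply: rt_trans mv.
apply: rt_trans (_ : clos_refl_trans _ _ (v ++ (y ++ z) ++ i :: w) _).
  exact: comm_equiv_allowed.
apply: rt_step; exists (size (v ++ y)), l.+1; split.
  exists (v ++ y), w, d, d'; split=> //.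
    by rewrite -ezr cat_rcons -!catA.
  by rewrite -!catA.
right; rewrite /affected.
have -> : v ++ (y ++ z) ++ i :: w = (v ++ y) ++ rcons z i ++ w.
  by rewrite cat_rcons -!catA.
rewrite betas_cat drop_size_cat ?size_betas // betas_cat map_cat.
rewrite take_size_cat; last by rewrite size_map size_betas size_rcons sz.
by rewrite betas_rcons map_rcons last_rcons.
Qed.

End Block.

(** * Crossing the blocks *)

(** A sequence sorted by [f] splits into the part where [f < k] and the rest. *)
Lemma sorted_split (T : eqType) (f : T -> nat) (s : seq T) (k : nat) :
    pairwise (fun x y => f x <= f y)%N s ->
  exists m, {in take m s, forall x, f x < k}%N /\
            {in drop m s, forall x, k <= f x}%N.
Proof.
elim: s => [|x s IHs] /=; first by exists 0.
case/andP=> /allP hx /IHs[m [h1 h2]].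
have [kx|xk] := leqP k (f x).
  exists 0; split=> // y; rewrite drop0 inE => /predU1P[-> //|/hx].
  exact: leq_trans.
by exists m.+1; split=> // y; rewrite /= inE => /predU1P[-> //|/h1].
Qed.

Lemma prec_lead b c : prec Delta e b c -> (lead b <= lead c)%N.
Proof. by case/orP=> [/ltnW|/andP[/eqP ->]]. Qed.

(** The zero sequence is minimal among nonnegative ones. *)
Lemma ltxi_ge0 (s t : seq R) : all (>= 0) s -> all (pred1 0) t ->
  size s = size t -> (s < t :> seqlexi R)%O = false.
Proof.
elim: s t => [|x s IHs] [|y t] //= /andP[x0 s0] /andP[/eqP -> t0] [st].
by rewrite ltxi_cons x0 /= IHs // andbF.
Qed.

(** The simple root [al (e k)] comes first among the positive roots of lead
    [k]. *)
Lemma prec_simple b (k : 'I_n) : b \in Pos -> prec Delta e b (al (e k)) ->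
  (lead b < k)%N.
Proof.
move=> /posP[_ b0]; rewrite /prec lead_simple => /orP[//|/andP[/eqP lb]].
have cn c m : (m < n)%N ->
    exists j : 'I_n, m = j /\ (coefs Delta e c)`_m = coord Delta (e j) c.
  by move=> ltn; exists (Ordinal ltn); rewrite -nth_coefs.
rewrite ltxi_ge0 //.
- apply/allP=> x /mapP[y /mem_drop /mapP[j _ ->] ->].
  have [j' [_ ->]] := cn b _ (eq_ind_r (fun l => (l < n)%N) (ltn_ord k) lb).
  by rewrite /= divr_ge0.
- apply/allP=> x /mapP[y]; rewrite lead_simple.
  case/(nthP 0)=> i; rewrite size_drop size_coefs nth_drop => ik <- -> /=.
  have [|j [ej ->]] := cn (al (e k)) (k.+1 + i)%N; first by lia.
  rewrite (coord_simple baseP) (inj_eq perm_inj).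
  have -> : (j == k) = false by apply/eqP=> jk; move: ej; rewrite jk; lia.
  by rewrite mul0r.
by rewrite !size_map !size_drop !size_coefs lb lead_simple.
Qed.

Hypothesis e_good : good_enumeration Delta e.

(** Here [v] consists of the blocks of lead less than [k], and [al i0] comes
    next.  Blocks are crossed one after the other, from lead [k - 1] down to
    lead 0. *)
Lemma cross_blocks k (v : seq 'I_n) i w i0 : (k <= n)%N -> reduced (rcons v i) ->
    (forall b, b \in Pos -> (b \in betas v) = (lead b < k)%N) ->
    pairwise (fun b c => lead b <= lead c)%N (betas v) ->
    weyl v (al i) = al i0 ->
  exists w', clos_refl_trans _ (allowed_move Delta i0) (v ++ i :: w) (i0 :: w').
Proof.
elim: k v i w => [|k IHk] v i w kn hr vb vs e0.
  have hv : reduced v by move: hr; rewrite -cats1; apply: reduced_prefix.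
  case: v {vs} hr vb e0 hv => [_ _ /(al_inj baseP) -> _|j v _ vb _ hv].
    by exists w; apply: rt_refl.
  have jb : al j \in betas (j :: v) by rewrite mem_head.
  by move: (jb); rewrite vb ?(simple_pos baseP).
have hv : reduced v by move: hr; rewrite -cats1; apply: reduced_prefix.
have [m [h1 h2]] := sorted_split k vs.
set v1 := take m v; set x := drop m v.
have ev : v = v1 ++ x by rewrite cat_take_drop.
have hv1 : reduced v1 by move: hv; rewrite ev; apply: reduced_prefix.
have v1b b : b \in Pos -> (b \in betas v1) = (lead b < k)%N.
  move=> bP; rewrite /v1 betas_take; apply/idP/idP => [/h1 //|bk].
  have : b \in betas v by rewrite vb // ltnW.
  rewrite -{1}(cat_take_drop m (betas v)) mem_cat => /orP[//|/h2].
  by rewrite leqNgt bk.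
have hr' : reduced (v1 ++ rcons x i) by rewrite -rcons_cat -ev.
have [|||j [x' [hj ej mv]]] := @block_pass (Ordinal kn) v1 hv1 v1b _ i0 x i w hr'.
- exact: e_good.
- move=> b; rewrite -ev => bv; rewrite -ltnS -vb //.
  by case: (betas_inv rootP baseP hv bv).
- by rewrite -ev.
have [|w' mv'] := IHk v1 j (x' ++ w) (ltnW kn) hj v1b _ ej.
  move: vs; rewrite -(cat_take_drop m (betas v)) pairwise_cat -betas_take.
  by case/and3P.
exists w'; apply: rt_trans mv'.
by move: mv; rewrite ev -catA.
Qed.

End Blocks.

Theorem lemma4p17 (R : realType) (n : nat) (Phi : seq 'rV[R]_n)
    (Delta : n.-tuple 'rV[R]_n) (e : 'S_n) (w : seq 'I_n) :
  root_system Phi -> irreducible Phi -> is_base Delta Phi ->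
  good_enumeration Delta e ->
  corresponds Delta Phi (prec Delta e) w ->
  simply_braided Delta w.
Proof.
move=> rootP _ baseP e_good [[w_red _] w_betas w_prec] i0.
pose k := (e^-1 i0)%g; have ek : e k = i0 by rewrite permKV.
have : tnth Delta i0 \in betas Delta w by rewrite w_betas (simple_pos baseP).
case/betas_split => u [i [t [ew ei]]].
have hui : reduced Delta (rcons u i).
  by move: w_red; rewrite ew -cat_rcons; apply: reduced_prefix.
move: w_prec; rewrite ew betas_cat /= -ei pairwise_cat /=.
move=> /and3P[/allrelP h1 h2 /andP[/allP h3 _]].
have lk : lead Delta e (tnth Delta i0) = k by rewrite -ek (lead_simple baseP).
apply: (cross_blocks rootP baseP e_good _ (ltnW (ltn_ord k)) hui) => //.
  move=> b bP; apply/idP/idP => [bu|bk].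
    by apply: (prec_simple baseP bP); rewrite ek; apply: h1; rewrite ?mem_head.
  have : b \in betas Delta w by rewrite w_betas.
  rewrite ew betas_cat mem_cat /= -ei => /orP[//|]; rewrite inE => /predU1P[eb|].
    by move: bk; rewrite eb lk ltnn.
  by move/h3/prec_lead; rewrite lk leqNgt bk.
by apply: sub_pairwise h2 => b c; apply: prec_lead.
Qed.
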